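(* Let $n \geq 1$ and $\epsilon > 0$. In the space of finitely presentable $n$-parameter persistence modules equipped with the interleaving distance, the $\epsilon$-indecomposable modules form an open set.
   Context: Fix a field $\mathbb{k}$ and let $\mathbf{vec}$ be the category of finite dimensional $\mathbb{k}$-vector spaces. $\mathbf{R}^n$ is the poset $\mathbb{R}^n$ with the product (componentwise) order, viewed as a category. An $n$-parameter persistence module is a functor $M : \mathbf{R}^n \to \mathbf{vec}$; morphisms are natural transformations. For $i \in \mathbf{R}^n$, let $\mathsf{P}_i : \mathbf{R}^n \to \mathbf{vec}$ be the functor with $\mathsf{P}_i(j) = \mathbb{k}$ if $i \leq j$ and $0$ otherwise, all structure morphisms not forced to be zero being the identity. A module is finitely presentable if it is isomorphic to the cokernel of a morphism $\bigoplus_{j \in J} \mathsf{P}_j \to \bigoplus_{i \in I} \mathsf{P}_i$ with $I, J$ finite multisets of elements of $\mathbf{R}^n$. A module is decomposable if it is isomorphic to $A \oplus B$ with $A, B$ both non-zero; it is indecomposable if it is non-zero and not decomposable. For $r \in \mathbb{R}$ and $s \in \mathbf{R}^n$, $s + r$ denotes $(s_1+r,\dots,s_n+r)$. A module $M$ is strictly $\epsilon$-trivial if there exists $\epsilon' < \epsilon$ (with $\epsilon' \geq 0$) such that the structure morphism $M(r) \to M(r+\epsilon')$ is zero for every $r \in \mathbf{R}^n$. A module is $\epsilon$-indecomposable if it is isomorphic to a direct sum of an indecomposable module and a strictly $\epsilon$-trivial module. Interleavings: the shift $M[r]$ is defined by $M[r](s) = M(s+r)$, with the corresponding structure morphisms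 (and similarly $f[r]$ for morphisms $f$). For $r \geq 0$, $\eta^M_r : M \to M[r]$ is the natural transformation given by the structure morphisms $M(a) \to M(a+r)$. For $\epsilon \geq 0$, an $\epsilon$-interleaving between $M$ and $N$ is a pair of morphisms $f : M \to N[\epsilon]$, $g : N \to M[\epsilon]$ with $g[\epsilon]\circ f = \eta^M_{2\epsilon}$ and $f[\epsilon] \circ g = \eta^N_{2\epsilon}$. The interleaving distance is $d_I(M,N) = \inf\{\epsilon \geq 0 : M \text{ and } N \text{ are } \epsilon\text{-interleaved}\} \in [0,\infty]$. The space of finitely presentable $n$-parameter persistence modules is the set of isomorphism classes of finitely presentable modules $\mathbf{R}^n \to \mathbf{vec}$, with the topology generated by the open balls of $d_I$ (which is an extended metric on this set). *)

(* Defs.v *)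
From HB Require Import structures.
From mathcomp Require Import all_boot all_order all_algebra.
From mathcomp Require Import all_classical all_reals all_analysis.

Set Implicit Arguments.
Unset Strict Implicit.
Unset Printing Implicit Defensive.

Import Order.TTheory GRing.Theory Num.Theory.

Local Open Scope classical_set_scope.
Local Open Scope ring_scope.

(* The universe constraints of MathComp-Analysis place the carriers of         *)
(* topologicalType and the T of [set T] strictly below the type vectType K,   *)
(* hence below the type of persistence modules.  Subsets are therefore bare   *)
(* predicates here, and the topology generated by a family is spelled out.    *)
Section GeneratedTopology.
Context (X : Type).

(* The empty set is the union of the empty family. *)
Definition is_topology (T : (X -> Prop) -> Prop) : Prop :=
  [/\ T (fun _ => True),
      forall U V, T U -> T V -> T (fun x => U x /\ V x)
    & forall F : (X -> Prop) -> Prop, (forall U, F U -> T U) ->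
        T (fun x => exists U, F U /\ U x)].

Definition generated_open (B : (X -> Prop) -> Prop) (U : X -> Prop) : Prop :=
  forall T, is_topology T -> (forall V, B V -> T V) -> T U.

End GeneratedTopology.

Section PersistenceModules.
Context (K : fieldType) (R : realType) (n : nat).
Implicit Types (a b c : 'rV[R]_n) (r e : R).

Definition le_pt a b : bool := [forall i, a ord0 i <= b ord0 i].

Definition shift_pt a r : 'rV[R]_n := a + const_mx r.

Lemma le_ptxx a : le_pt a a.
Proof. by apply/forallP. Qed.

Lemma le_pt_trans a b c : le_pt a b -> le_pt b c -> le_pt a c.
Proof.
by move=> /forallP ab /forallP bc; apply/forallP => i; exact: le_trans (bc i).
Qed.

Lemma le_pt_shift r a b : le_pt a b -> le_pt (shift_pt a r) (shift_pt b r).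
Proof. by move=> /forallP ab; apply/forallP => i; rewrite !mxE lerD2r. Qed.

Lemma le_shift_pt r a : 0 <= r -> le_pt a (shift_pt a r).
Proof. by move=> r0; apply/forallP => i; rewrite !mxE lerDl. Qed.

Lemma le_shift_pt2 r a : 0 <= r -> le_pt a (shift_pt (shift_pt a r) r).
Proof.
by move=> r0; exact: le_pt_trans (le_shift_pt _ r0) (le_shift_pt _ r0).
Qed.

(* Since le_pt is boolean, the proof argument of pm_map is irrelevant. *)
Record pmod := PMod {
  pm_obj :> 'rV[R]_n -> vectType K;
  pm_map : forall a b, le_pt a b -> 'Hom(pm_obj a, pm_obj b);
  pm_id : forall a (h : le_pt a a), pm_map h = \1%VF;
  pm_comp : forall a b c (h : le_pt a b) (k : le_pt b c) (l : le_pt a c),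
    (pm_map k \o pm_map h)%VF = pm_map l }.

Implicit Types M N L A B C D : pmod.

Record pmor M N := PMor {
  mor_at :> forall a, 'Hom(M a, N a);
  mor_nat : forall a b (h : le_pt a b),
    (mor_at b \o pm_map M h)%VF = (pm_map N h \o mor_at a)%VF }.

Lemma pmor_ext M N (f g : pmor M N) : (forall a, f a = g a) -> f = g.
Proof.
case: f g => [f fP] [g gP] /= fg.
have efg : f = g by exact: functional_extensionality_dep.
by rewrite efg in fP *; congr PMor; exact: Prop_irrelevance.
Qed.

Fact pmor_id_nat M a b (h : le_pt a b) :
  (\1 \o pm_map M h)%VF = (pm_map M h \o \1)%VF.
Proof. by rewrite comp_lfun1l comp_lfun1r. Qed.

Definition pmor_id M : pmor M M := PMor (@pmor_id_nat M).

Fact pmor_comp_nat M N L (g : pmor N L) (f : pmor M N) a b (h : le_pt a b) :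
  (g b \o f b \o pm_map M h)%VF = (pm_map L h \o (g a \o f a))%VF.
Proof. by rewrite -comp_lfunA mor_nat comp_lfunA mor_nat comp_lfunA. Qed.

Definition pmor_comp M N L (g : pmor N L) (f : pmor M N) : pmor M L :=
  PMor (pmor_comp_nat g f).

Definition piso M N : Prop :=
  exists (f : pmor M N) (g : pmor N M),
    pmor_comp g f = pmor_id M /\ pmor_comp f g = pmor_id N.

Definition zero_pmod : pmod :=
  @PMod (fun=> 'rV[K]_0) (fun _ _ _ => \1%VF) (fun _ _ => erefl)
    (fun _ _ _ _ _ _ => comp_lfun1l _).

Definition is_zero M : Prop := forall a (v : M a), v = 0.

Section PairLfun.
Context (U1 U2 V1 V2 : vectType K) (f : 'Hom(U1, V1)) (g : 'Hom(U2, V2)).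

Definition pair_fun (u : U1 * U2) : V1 * V2 := (f u.1, g u.2).

Lemma pair_fun_linear : linear pair_fun.
Proof. by move=> k u v; rewrite /pair_fun /= !linearP. Qed.

HB.instance Definition _ :=
  GRing.isLinear.Build K (U1 * U2)%type (V1 * V2)%type _ pair_fun
    pair_fun_linear.

Definition pair_lfun : 'Hom((U1 * U2)%type, (V1 * V2)%type) := linfun pair_fun.

Lemma pair_lfunE u : pair_lfun u = (f u.1, g u.2).
Proof. by rewrite lfunE. Qed.

End PairLfun.

Section DirectSum.
Context (A B : pmod).

Definition dsum_map a b (h : le_pt a b) :
    'Hom((A a * B a)%type, (A b * B b)%type) :=
  pair_lfun (pm_map A h) (pm_map B h).

Fact dsum_id a (h : le_pt a a) : dsum_map h = \1%VF.
Proof. by apply/lfunP => -[u v]; rewrite pair_lfunE !pm_id !id_lfunE. Qed.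

Fact dsum_comp a b c (h : le_pt a b) (k : le_pt b c) (l : le_pt a c) :
  (dsum_map k \o dsum_map h)%VF = dsum_map l.
Proof.
apply/lfunP => -[u v].
by rewrite comp_lfunE !pair_lfunE /= -(pm_comp A h k l) -(pm_comp B h k l)
   !comp_lfunE.
Qed.

Definition dsum : pmod := PMod dsum_id dsum_comp.

End DirectSum.

Definition free_space (s : bool) : vectType K :=
  if s then (K^o : vectType K) else ('rV[K]_0 : vectType K).

Definition free_map (s t : bool) : 'Hom(free_space s, free_space t) :=
  match s, t with
  | true, true => \1%VF
  | _, _ => 0
  end.

Section FreeModule.
Context (i : 'rV[R]_n).

Fact free_id a (_ : le_pt a a) : free_map (le_pt i a) (le_pt i a) = \1%VF.
Proof.
case: (le_pt i a) => //=.
by apply/lfunP => v; rewrite thinmx0 [RHS]thinmx0.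
Qed.

Fact free_comp a b c (h : le_pt a b) (k : le_pt b c) (_ : le_pt a c) :
  (free_map (le_pt i b) (le_pt i c) \o free_map (le_pt i a) (le_pt i b))%VF =
  free_map (le_pt i a) (le_pt i c).
Proof.
case ia : (le_pt i a); case ib : (le_pt i b); case ic : (le_pt i c) => //=;
  rewrite ?comp_lfun1l ?comp_lfun0l ?comp_lfun0r //.
by rewrite (le_pt_trans ia h) in ib.
Qed.

Definition free_pmod : pmod := PMod free_id free_comp.

End FreeModule.

(* A finite multiset is given by a list enumerating it. *)
Definition free_sum (s : seq 'rV[R]_n) : pmod :=
  foldr (fun i => dsum (free_pmod i)) zero_pmod s.

Definition is_cokernel A B C (f : pmor A B) (q : pmor B C) : Prop :=
  (forall a, (q a \o f a)%VF = 0) /\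
  (forall D (h : pmor B D), (forall a, (h a \o f a)%VF = 0) ->
     exists! u : pmor C D, pmor_comp u q = h).

Definition finitely_presentable M : Prop :=
  exists (J I : seq 'rV[R]_n) (f : pmor (free_sum J) (free_sum I))
         (C : pmod) (q : pmor (free_sum I) C),
    is_cokernel f q /\ piso M C.

Definition decomposable M : Prop :=
  exists A B, [/\ ~ is_zero A, ~ is_zero B & piso M (dsum A B)].

Definition indecomposable M : Prop := ~ is_zero M /\ ~ decomposable M.

Definition strictly_trivial e M : Prop :=
  exists e' : R, exists e'0 : 0 <= e',
    e' < e /\ forall a, pm_map M (le_shift_pt a e'0) = 0.

Definition eps_indecomposable e M : Prop :=
  exists A B, [/\ indecomposable A, strictly_trivial e B & piso M (dsum A B)].

Definition shift_pmod r M : pmod :=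
  @PMod (fun a => M (shift_pt a r))
    (fun a b h => pm_map M (le_pt_shift r h))
    (fun a h => pm_id M (le_pt_shift r h))
    (fun a b c h k l =>
       pm_comp M (le_pt_shift r h) (le_pt_shift r k) (le_pt_shift r l)).

Definition shift_pmor r M N (f : pmor M N) :
    pmor (shift_pmod r M) (shift_pmod r N) :=
  @PMor (shift_pmod r M) (shift_pmod r N) (fun a => f (shift_pt a r))
    (fun a b h => mor_nat f (le_pt_shift r h)).

Fact eta2_nat r (r0 : 0 <= r) M a b (h : le_pt a b) :
  (pm_map M (le_shift_pt2 b r0) \o pm_map M h)%VF =
  (pm_map (shift_pmod r (shift_pmod r M)) h \o pm_map M (le_shift_pt2 a r0))%VF.
Proof. by rewrite !(pm_comp M _ _ (le_pt_trans h (le_shift_pt2 b r0))). Qed.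

(* The structure morphism from M to M[2r].  It is given the codomain M[r][r], *)
(* because a + r + r and a + 2r are equal but not convertible.                *)
Definition eta2 r (r0 : 0 <= r) M : pmor M (shift_pmod r (shift_pmod r M)) :=
  @PMor M (shift_pmod r (shift_pmod r M))
    (fun a => pm_map M (le_shift_pt2 a r0)) (eta2_nat r0 M).

Definition interleaved e M N : Prop :=
  exists (e0 : 0 <= e) (f : pmor M (shift_pmod e N))
         (g : pmor N (shift_pmod e M)),
    pmor_comp (shift_pmor e g) f = eta2 e0 M /\
    pmor_comp (shift_pmor e f) g = eta2 e0 N.

Definition interleaving_dist M N : \bar R :=
  ereal_inf [set e%:E | e in [set e | interleaved e M N]].

Lemma piso_refl M : piso M M.
Proof.
by exists (pmor_id M), (pmor_id M); split; apply: pmor_ext => a;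
  rewrite /= comp_lfun1l.
Qed.

Lemma piso_sym M N : piso M N -> piso N M.
Proof. by move=> [f [g [gf fg]]]; exists g, f. Qed.

Lemma pmor_compA M N L A (h : pmor L A) (g : pmor N L) (f : pmor M N) :
  pmor_comp h (pmor_comp g f) = pmor_comp (pmor_comp h g) f.
Proof. by apply: pmor_ext => a; rewrite /= comp_lfunA. Qed.

Lemma pmor_comp1l M N (f : pmor M N) : pmor_comp (pmor_id N) f = f.
Proof. by apply: pmor_ext => a; rewrite /= comp_lfun1l. Qed.

Lemma pmor_comp1r M N (f : pmor M N) : pmor_comp f (pmor_id M) = f.
Proof. by apply: pmor_ext => a; rewrite /= comp_lfun1r. Qed.

Lemma piso_trans M N L : piso M N -> piso N L -> piso M L.
Proof.
move=> [f [g [gf fg]]] [h [k [kh hk]]].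
exists (pmor_comp h f), (pmor_comp g k); split.
- by rewrite -pmor_compA (pmor_compA k) kh pmor_comp1l.
- by rewrite -pmor_compA (pmor_compA f) fg pmor_comp1l.
Qed.

Lemma shift_pmor_comp r M N L (g : pmor N L) (f : pmor M N) :
  shift_pmor r (pmor_comp g f) = pmor_comp (shift_pmor r g) (shift_pmor r f).
Proof. exact: pmor_ext. Qed.

Lemma shift_pmor_id r M : shift_pmor r (pmor_id M) = pmor_id (shift_pmod r M).
Proof. exact: pmor_ext. Qed.

Lemma eta2_natural r (r0 : 0 <= r) M N (f : pmor M N) :
  pmor_comp (shift_pmor r (shift_pmor r f)) (eta2 r0 M) =
  pmor_comp (eta2 r0 N) f.
Proof. by apply: pmor_ext => a; rewrite /= mor_nat. Qed.

Lemma interleaved_sym e M N : interleaved e M N -> interleaved e N M.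
Proof. by move=> [e0 [f [g [gf fg]]]]; exists e0, g, f. Qed.

Lemma interleaved_piso e M M' N :
  piso M M' -> interleaved e M N -> interleaved e M' N.
Proof.
move=> [u [v [vu uv]]] [e0 [f [g [gf fg]]]].
exists e0, (pmor_comp f v), (pmor_comp (shift_pmor e u) g); split.
- rewrite shift_pmor_comp -pmor_compA (pmor_compA _ f) gf pmor_compA.
  by rewrite eta2_natural -pmor_compA uv pmor_comp1r.
- rewrite shift_pmor_comp -pmor_compA (pmor_compA (shift_pmor e v)).
  by rewrite -shift_pmor_comp vu shift_pmor_id pmor_comp1l.
Qed.

Lemma interleaving_dist_piso M M' N N' :
  piso M M' -> piso N N' -> interleaving_dist M N = interleaving_dist M' N'.
Proof.
move=> MM' NN'; congr (ereal_inf (_ @` _)); apply/seteqP; split=> e /=.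
- by move/(interleaved_piso MM')/interleaved_sym/(interleaved_piso NN')
    /interleaved_sym.
- by move/(interleaved_piso (piso_sym MM'))/interleaved_sym
    /(interleaved_piso (piso_sym NN'))/interleaved_sym.
Qed.

Record fpmod := FPMod {
  fp_mod :> pmod;
  fp_modP : finitely_presentable fp_mod }.

Record fpclass := FPClass {
  in_class :> fpmod -> Prop;
  fpclassP : exists M : fpmod, forall N : fpmod, in_class N <-> piso M N }.

(* Any two representatives will do, see fpclass_distE below. *)
Definition fpclass_repr (c : fpclass) : fpmod := sval (cid (fpclassP c)).

Definition fpclass_dist (c d : fpclass) : \bar R :=
  interleaving_dist (fpclass_repr c) (fpclass_repr d).

Lemma fpclass_distE (c d : fpclass) (M N : fpmod) :
  c M -> d N -> fpclass_dist c d = interleaving_dist M N.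
Proof.
have repr_iso (x : fpclass) (L : fpmod) : x L -> piso (fpclass_repr x) L.
  rewrite /fpclass_repr; case: cid => L0 /= xE xL; exact/xE.
by move=> /repr_iso cM /repr_iso dN; exact: interleaving_dist_piso.
Qed.

Definition fpclass_ball (c : fpclass) r (d : fpclass) : Prop :=
  (fpclass_dist c d < r%:E)%E.

Definition is_fpclass_ball (B : fpclass -> Prop) : Prop :=
  exists (c : fpclass) r, 0 < r /\ B = fpclass_ball c r.

Definition fpclass_open : (fpclass -> Prop) -> Prop :=
  generated_open is_fpclass_ball.

Definition eps_indecomposable_class e (c : fpclass) : Prop :=
  exists M : fpmod, c M /\ eps_indecomposable e M.

End PersistenceModules.

(* Main.v *)
From HB Require Import structures.
Require Import Defs.
From mathcomp Require Import all_boot all_order all_algebra.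
From mathcomp Require Import all_classical all_reals all_analysis.
From mathcomp Require Import lra.

(* Let M = A + B with A indecomposable and B killed by shifts of r < e.  When M
   is finitely presented and d is small, every map M -> M[2d] lifts uniquely
   through the structure map M -> M[2d], because the generators and relations
   sit at grades where M is locally constant to the right.  If N is
   d-interleaved with M, an idempotent of N is thereby transported to an
   idempotent E of M.  By Fitting's lemma one of the compositions A -> M -> A
   through E and 1 - E is onto, so the image of the other idempotent is a
   quotient of B, and the corresponding summand of N is killed by shifts of
   4d + r < e.  Hence in every splitting N = X + Y one summand is killed; a
   splitting with Y killed and X of minimal dimension has X indecomposable. *)

Set Implicit Arguments.
Unset Strict Implicit.
Unset Printing Implicit Defensive.

Import Order.TTheory GRing.Theory Num.Theory.
Local Open Scope ring_scope.

(** * Linear isomorphisms and iterates of an endomorphism *)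

Section LinearMaps.
Context (K : fieldType).
Implicit Types U V W : vectType K.

Lemma lfun_of_linear U V (f : U -> V) :
  linear f -> exists g : 'Hom(U, V), forall x, g x = f x.
Proof.
move=> fl.
pose F : {linear U -> V} := HB.pack f (GRing.isLinear.Build _ _ _ _ f fl).
by exists (linfun F) => x; rewrite lfunE.
Qed.

Lemma exists_inl U V : exists f : 'Hom(U, (U * V)%type), forall x, f x = (x, 0).
Proof.
by apply: lfun_of_linear => k x y; congr pair => /=; rewrite scaler0 addr0.
Qed.

Lemma exists_inr U V : exists f : 'Hom(V, (U * V)%type), forall x, f x = (0, x).
Proof.
by apply: lfun_of_linear => k x y; congr pair => /=; rewrite scaler0 addr0.
Qed.

Definition lfun_bij U V (f : 'Hom(U, V)) : Prop :=
  exists g : 'Hom(V, U), cancel f g /\ cancel g f.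

Lemma lfun_bij_inj U V (f : 'Hom(U, V)) : lfun_bij f -> injective f.
Proof. by move=> [g [fK _]]; exact: can_inj fK. Qed.

Lemma lfun_bij_surj U V (f : 'Hom(U, V)) : lfun_bij f -> forall y, exists x, f x = y.
Proof. by move=> [g [_ gK]] y; exists (g y). Qed.

Lemma pair_lfun_bij U V U' V' (f : 'Hom(U, V)) (g : 'Hom(U', V')) :
  lfun_bij f -> lfun_bij g -> lfun_bij (pair_lfun f g).
Proof.
move=> [f' [fK f'K]] [g' [gK g'K]]; exists (pair_lfun f' g').
by split=> -[x y]; rewrite !pair_lfunE /= ?fK ?gK ?f'K ?g'K.
Qed.

Lemma free_map_bij (s t : bool) : s = t -> lfun_bij (free_map K s t).
Proof.
move=> <-; case: s; last first.
  by exists 0; split=> x; rewrite thinmx0 [RHS]thinmx0.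
by exists \1%VF; split=> x; rewrite /= !id_lfunE.
Qed.

Lemma lfun_bijI U V (f : 'Hom(U, V)) :
  injective f -> (forall y, exists x, f x = y) -> lfun_bij f.
Proof.
move=> finj fsurj; exists f^-1%VF; split=> [|y].
  by apply: lker0_lfunK; apply/lker0P.
by apply: limg_lfunVK; have [x <-] := fsurj y; apply: memv_img; exact: memvf.
Qed.

Definition lfun_iter V (k : nat) (f : 'End(V)) : 'End(V) :=
  iter k (comp_lfun f) \1%VF.

Lemma lfun_iterE V k (f : 'End(V)) x : lfun_iter k f x = iter k f x.
Proof. by elim: k => [|k IHk]; rewrite /= ?id_lfunE ?comp_lfunE ?IHk. Qed.

(** Some [k] attains the least rank among the iterates. Images descend, so they are constant from
    [k] on; by rank-nullity the ascending kernels are constant from [k] on as well. *)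
Lemma fitting_index V (f : 'End(V)) : exists k, forall j x,
  (exists y, iter k f x = iter j f y) /\ (iter j f x = 0 -> iter k f x = 0).
Proof.
pose d k := \dim (limg (lfun_iter k f)).
have [|_ /asboolP[k <-] dmin] := @ex_minnP (fun m => `[< exists k, d k = m >]).
  by exists (d 0%N); apply/asboolP; exists 0%N.
have {}dmin j : (d k <= d j)%N by apply: dmin; apply/asboolP; exists j.
have im j : (limg (lfun_iter (k + j) f) = limg (lfun_iter k f))%VS.
  apply/eqP; rewrite eqEdim dmin andbT; apply/subvP => _ /memv_imgP[x _ ->].
  by rewrite lfun_iterE iterD -!lfun_iterE memv_img ?memvf.
have ker j : (lker (lfun_iter (k + j) f) = lker (lfun_iter k f))%VS.
  apply/esym/eqP; rewrite eqEdim; apply/andP; split.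
    apply/subvP => x; rewrite !memv_ker !lfun_iterE addnC iterD => /eqP ->.
    by rewrite -lfun_iterE raddf0.
  have := limg_ker_dim (lfun_iter (k + j) f) fullv.
  rewrite -(limg_ker_dim (lfun_iter k f) fullv) im.
  by move/eqP; rewrite eqn_add2r !capfv => /eqP ->.
exists k => j x; split.
  have : lfun_iter k f x \in limg (lfun_iter (k + j) f).
    by rewrite im memv_img ?memvf.
  move=> /memv_imgP[y _]; rewrite !lfun_iterE addnC iterD => ->.
  by exists (iter k f y).
move=> fx; apply/eqP; rewrite -lfun_iterE -memv_ker -(ker j) memv_ker.
by rewrite lfun_iterE iterD fx -lfun_iterE raddf0.
Qed.

(** Geometric series: the sum of the [iter i f y] for i < m solves the equation up to the error
    [iter m f y], which vanishes at m = k. *)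
Lemma lfun_sub_nilp_surj V k (f : 'End(V)) : (forall x, iter k f x = 0) ->
  forall y, exists x, x - f x = y.
Proof.
move=> fk y; suff H m : exists x, x - f x = y - iter m f y.
  by have [x xE] := H k; exists x; rewrite xE fk subr0.
elim: m => [|m [x xE]]; first by exists 0; rewrite raddf0 !subrr.
exists (x + iter m f y); rewrite raddfD opprD addrACA xE.
by rewrite addrA subrK.
Qed.

Lemma lfun_bij_dim U V (f : 'Hom(U, V)) : lfun_bij f -> dim U = dim V.
Proof.
move=> fb; rewrite -!dimvf.
have <- : limg f = fullv.
  apply/vspaceP => y; have [x <-] := lfun_bij_surj fb y.
  by rewrite memvf memv_img ?memvf.
apply/esym/limg_dim_eq/eqP; rewrite capfv; apply/lker0P; exact: lfun_bij_inj.
Qed.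

End LinearMaps.

(** * Elementwise calculus of morphisms *)

Section Modules.
Context (K : fieldType) (R : realType) (n : nat).
Local Notation pt := 'rV[R]_n.
Local Notation pmod := (pmod K R n).
Implicit Types (a b c i j p : pt) (M N L A B C D X Y : pmod).

Lemma pm_mapC M a b c (h : le_pt a b) (k : le_pt b c) (l : le_pt a c) (x : M a) :
  pm_map M k (pm_map M h x) = pm_map M l x.
Proof. by rewrite -(pm_comp M h k l) comp_lfunE. Qed.

Lemma pm_map1 M a (h : le_pt a a) (x : M a) : pm_map M h x = x.
Proof. by rewrite pm_id id_lfunE. Qed.

Lemma mor_natE M N (f : pmor M N) a b (h : le_pt a b) (x : M a) :
  f b (pm_map M h x) = pm_map N h (f a x).
Proof. by have /lfunP/(_ x) := mor_nat f h; rewrite !comp_lfunE. Qed.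

Lemma pmor_compE M N L (g : pmor N L) (f : pmor M N) a (x : M a) :
  pmor_comp g f a x = g a (f a x).
Proof. by rewrite /= comp_lfunE. Qed.

Lemma pmor_idE M a (x : M a) : pmor_id M a x = x.
Proof. by rewrite /= id_lfunE. Qed.

Lemma pmorP M N (f g : pmor M N) : (forall a x, f a x = g a x) -> f = g.
Proof. by move=> fg; apply: pmor_ext => a; apply/lfunP => x. Qed.

Lemma exists_pmor M N (F : forall a, 'Hom(M a, N a)) :
  (forall a b (h : le_pt a b) x, F b (pm_map M h x) = pm_map N h (F a x)) ->
  exists f : pmor M N, forall a, f a = F a.
Proof.
move=> Fnat.
have Fnat' a b (h : le_pt a b) : (F b \o pm_map M h = pm_map N h \o F a)%VF.
  by apply/lfunP => x; rewrite !comp_lfunE Fnat.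
by exists (PMor Fnat').
Qed.

Lemma exists_sub M N (f g : pmor M N) :
  exists h : pmor M N, forall a x, h a x = f a x - g a x.
Proof.
have [|h hE] := @exists_pmor M N (fun a => f a - g a).
  by move=> a b h x; rewrite !lfunE /= !lfunE /= !mor_natE raddfB.
by exists h => a x; rewrite hE !lfunE /= lfunE.
Qed.

Lemma exists_add M N (f g : pmor M N) :
  exists h : pmor M N, forall a x, h a x = f a x + g a x.
Proof.
have [|h hE] := @exists_pmor M N (fun a => f a + g a).
  by move=> a b h x; rewrite !lfunE /= !mor_natE raddfD.
by exists h => a x; rewrite hE !lfunE.
Qed.

Lemma exists_zero M N : exists h : pmor M N, forall a x, h a x = 0.
Proof.
have [|h hE] := @exists_pmor M N (fun a => 0).
  by move=> a b h x; rewrite !lfunE /= raddf0.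
by exists h => a x; rewrite hE lfunE.
Qed.

Lemma pisoP M N : piso M N <-> exists (f : pmor M N) (g : pmor N M),
  (forall a, cancel (f a) (g a)) /\ (forall a, cancel (g a) (f a)).
Proof.
split=> -[f [g [gf fg]]]; exists f, g.
  split=> a x; rewrite -pmor_compE ?gf ?fg pmor_idE //.
by split; apply: pmorP => a x; rewrite pmor_compE pmor_idE ?gf ?fg.
Qed.

(** * Direct sums: injections and projections *)

Section Dsum.
Context (A B : pmod).

Lemma dsum_mapE a b (h : le_pt a b) (x : dsum A B a) :
  pm_map (dsum A B) h x = (pm_map A h x.1, pm_map B h x.2).
Proof. by rewrite [LHS]pair_lfunE. Qed.

Lemma exists_dsum_inl : exists f : pmor A (dsum A B), forall a x, f a x = (x, 0).
Proof.
pose F a := sval (cid (exists_inl (A a) (B a))).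
have FE a := svalP (cid (exists_inl (A a) (B a))) : forall x, F a x = _.
have [|f fE] := @exists_pmor A (dsum A B) F.
  by move=> a b h x; rewrite dsum_mapE !FE /= raddf0.
by exists f => a x; rewrite fE FE.
Qed.

Lemma exists_dsum_inr : exists f : pmor B (dsum A B), forall a x, f a x = (0, x).
Proof.
pose F a := sval (cid (exists_inr (A a) (B a))).
have FE a := svalP (cid (exists_inr (A a) (B a))) : forall x, F a x = _.
have [|f fE] := @exists_pmor B (dsum A B) F.
  by move=> a b h x; rewrite dsum_mapE !FE /= raddf0.
by exists f => a x; rewrite fE FE.
Qed.

Lemma exists_dsum_fst : exists f : pmor (dsum A B) A, forall a x, f a x = x.1.
Proof.
have [|f fE] := @exists_pmor (dsum A B) A (fun a => linfun fst).
  by move=> a b h x; rewrite dsum_mapE !lfunE.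
by exists f => a x; rewrite fE lfunE.
Qed.

Lemma exists_dsum_snd : exists f : pmor (dsum A B) B, forall a x, f a x = x.2.
Proof.
have [|f fE] := @exists_pmor (dsum A B) B (fun a => linfun snd).
  by move=> a b h x; rewrite dsum_mapE !lfunE.
by exists f => a x; rewrite fE lfunE.
Qed.

End Dsum.

(** * Free modules: structure maps and uniqueness of maps out of them *)

Lemma free_sum_map_bij (s : seq pt) a b (h : le_pt a b) :
  (forall i, i \in s -> le_pt i b -> le_pt i a) ->
  lfun_bij (pm_map (free_sum K s) h).
Proof.
elim: s => [|i s IHs] sP /=.
  by exists \1%VF; split=> x; rewrite !id_lfunE.
apply: pair_lfun_bij; last by apply: IHs => j js; apply: sP; rewrite inE js orbT.
apply: free_map_bij; apply/idP/idP => [ia|]; first exact: le_pt_trans ia h.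
by apply: sP; rewrite inE eqxx.
Qed.

(** Above [i] every element comes from grade [i]; elsewhere the module is zero. *)
Lemma free_pmod_ext i D (h h' : pmor (free_pmod K i) D) :
  h i = h' i -> h = h'.
Proof.
move=> hi; apply: pmorP => a x; have [ia|ia] := boolP (le_pt i a).
  have [y <-] : exists y, pm_map (free_pmod K i) ia y = x.
    by apply: lfun_bij_surj; apply: free_map_bij; rewrite ia le_ptxx.
  by rewrite !mor_natE hi.
have -> : x = 0.
  move: x; rewrite /= (negbTE ia) => x; exact: thinmx0.
by rewrite !raddf0.
Qed.

Lemma free_sum_ext (s : seq pt) D (h h' : pmor (free_sum K s) D) :
  (forall i, i \in s -> h i = h' i) -> h = h'.
Proof.
elim: s h h' => [|i s IHs] h h' hP.
  by apply: pmorP => a x; rewrite (_ : x = 0) ?raddf0 //; apply: thinmx0.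
have [f fE] := exists_dsum_inl (free_pmod K i) (free_sum K s).
have [g gE] := exists_dsum_inr (free_pmod K i) (free_sum K s).
have hf : pmor_comp h f = pmor_comp h' f.
  by apply: free_pmod_ext; rewrite /= hP // inE eqxx.
have hg : pmor_comp h g = pmor_comp h' g.
  by apply: IHs => j js; rewrite /= hP // inE js orbT.
apply: pmorP => a [x y].
have -> : (x, y) = f a x + g a y by rewrite fE gE; congr pair; rewrite ?addr0 ?add0r.
have hfx : h a (f a x) = h' a (f a x).
  by have := congr1 (fun k : pmor _ _ => k a x) hf; rewrite !pmor_compE.
have hgy : h a (g a y) = h' a (g a y).
  by have := congr1 (fun k : pmor _ _ => k a y) hg; rewrite !pmor_compE.
by rewrite [LHS]raddfD [RHS]raddfD; congr (_ + _).
Qed.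

(** * Free and cofree modules, cokernels *)

(** Existence half of the Yoneda lemma: go back to grade [i], apply [F], and push forward in [M]. *)
Lemma exists_free_pmod_mor i M (F : 'Hom(free_pmod K i i, M i)) :
  exists f : pmor (free_pmod K i) M, f i = F.
Proof.
have bij a (ia : le_pt i a) : lfun_bij (pm_map (free_pmod K i) ia).
  by apply: free_map_bij; rewrite ia le_ptxx.
pose G a (ia : le_pt i a) := sval (cid (bij a ia)).
have GK a ia : cancel (pm_map (free_pmod K i) ia) (G a ia).
  by have [] := svalP (cid (bij a ia)).
(* The match supplies the proof of [le_pt i a] that [pm_map] and [G] take; off the up-set of [i] the
   source is zero. *)
pose H a : 'Hom(free_pmod K i a, M a) :=
  if @idP (le_pt i a) is ReflectT ia then (pm_map M ia \o F \o G a ia)%VF else 0.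
have HE a (ia : le_pt i a) x : H a (pm_map (free_pmod K i) ia x) = pm_map M ia (F x).
  rewrite /H; case: {-}_ / idP => [ia'|] //.
  by rewrite (bool_irrelevance ia ia') !comp_lfunE GK.
have [|f fE] := @exists_pmor (free_pmod K i) M H.
  move=> a b h x; have [ia|ia] := boolP (le_pt i a).
    have [y <-] := lfun_bij_surj (bij a ia) x.
    by rewrite (pm_mapC _ _ (le_pt_trans ia h)) !HE
       (pm_mapC _ _ (le_pt_trans ia h)).
  have -> : x = 0 by move: x; rewrite /= (negbTE ia) => x; exact: thinmx0.
  by rewrite !raddf0.
exists f; apply/lfunP => x.
by rewrite fE -{1}[x](pm_map1 (le_ptxx i)) HE pm_map1.
Qed.

(** Each generator is lifted on its own, by inverting [t] at its grade. *)
Lemma exists_free_sum_lift (s : seq pt) N N' (t : pmor N N')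
    (h : pmor (free_sum K s) N') :
  (forall i, i \in s -> lfun_bij (t i)) ->
  exists f : pmor (free_sum K s) N, pmor_comp t f = h.
Proof.
elim: s h => [|i s IHs] h tP.
  have [f fE] := exists_zero (free_sum K [::]) N.
  by exists f; apply: free_sum_ext.
have [u uE] := exists_dsum_inl (free_pmod K i) (free_sum K s).
have [v vE] := exists_dsum_inr (free_pmod K i) (free_sum K s).
have [w wE] := exists_dsum_fst (free_pmod K i) (free_sum K s).
have [z zE] := exists_dsum_snd (free_pmod K i) (free_sum K s).
have [|g gE] := IHs (pmor_comp h v).
  by move=> j js; apply: tP; rewrite inE js orbT.
have [|t' [tK t'K]] := tP i; first by rewrite inE eqxx.
have [f fE] := exists_free_pmod_mor (t' \o (h i \o u i))%VF.
have {}fE : pmor_comp t f = pmor_comp h u.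
  apply: free_pmod_ext; apply/lfunP => x.
  by rewrite !pmor_compE fE !comp_lfunE t'K.
have [k kE] := exists_add (pmor_comp f w) (pmor_comp g z).
exists k; apply: pmorP => a [x y].
rewrite pmor_compE kE !pmor_compE wE zE raddfD /=.
have -> : t a (f a x) = h a (u a x) by rewrite -!pmor_compE fE.
have -> : t a (g a y) = h a (v a y).
  by have := congr1 (fun k : pmor _ _ => k a y) gE; rewrite !pmor_compE.
by rewrite -[LHS]raddfD uE vE; congr (h a (_, _)); rewrite ?addr0 ?add0r.
Qed.

Definition cofree_space (V : vectType K) (s : bool) : vectType K :=
  if s then V else ('rV[K]_0 : vectType K).

Definition cofree_map V (s t : bool) : 'Hom(cofree_space V s, cofree_space V t) :=
  match s, t with
  | true, true => \1%VF
  | _, _ => 0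
  end.

Lemma cofree_map_bij V (s t : bool) : s = t -> lfun_bij (cofree_map V s t).
Proof.
move=> <-; case: s; last first.
  by exists 0; split=> x; rewrite thinmx0 [RHS]thinmx0.
by exists \1%VF; split=> x; rewrite /= !id_lfunE.
Qed.

Section Cofree.
Context (V : vectType K) (p : pt).

Fact cofree_id a (_ : le_pt a a) :
  cofree_map V (le_pt a p) (le_pt a p) = \1%VF.
Proof.
case: (le_pt a p) => //=.
by apply/lfunP => v; rewrite thinmx0 [RHS]thinmx0.
Qed.

Fact cofree_comp a b c (h : le_pt a b) (k : le_pt b c) (_ : le_pt a c) :
  (cofree_map V (le_pt b p) (le_pt c p) \o cofree_map V (le_pt a p) (le_pt b p))%VF =
  cofree_map V (le_pt a p) (le_pt c p).
Proof.
case ap : (le_pt a p); case bp : (le_pt b p); case cp : (le_pt c p) => //=;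
  rewrite ?comp_lfun1l ?comp_lfun0l ?comp_lfun0r //.
by rewrite (le_pt_trans k cp) in bp.
Qed.

(* Right adjoint of [M |-> M p]; testing a cokernel against these modules shows
   that it is computed pointwise. *)
Definition cofree_pmod : pmod := PMod cofree_id cofree_comp.

Lemma cofree_pmod_eq a (x y : cofree_pmod a) : ~~ le_pt a p -> x = y.
Proof.
move=> ap; move: x y; rewrite /= (negbTE ap) => x y.
by rewrite thinmx0 [RHS]thinmx0.
Qed.

Lemma cofree_pmod_ext B (h h' : pmor B cofree_pmod) : h p = h' p -> h = h'.
Proof.
move=> hp; apply: pmorP => a x; have [ap|ap] := boolP (le_pt a p).
  have inj : injective (pm_map cofree_pmod ap).
    by apply: lfun_bij_inj; apply: cofree_map_bij; rewrite ap le_ptxx.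
  by apply: inj; rewrite -!mor_natE hp.
exact: cofree_pmod_eq.
Qed.

(** Dual to the free case: push to grade [p], apply [F], and go back along the bijective structure
    map. *)
Lemma exists_cofree_pmod_mor B (F : 'Hom(B p, cofree_pmod p)) :
  exists f : pmor B cofree_pmod, f p = F.
Proof.
have bij a (ap : le_pt a p) : lfun_bij (pm_map cofree_pmod ap).
  by apply: cofree_map_bij; rewrite ap le_ptxx.
pose G a (ap : le_pt a p) := sval (cid (bij a ap)).
have KG a ap : cancel (G a ap) (pm_map cofree_pmod ap).
  by have [] := svalP (cid (bij a ap)).
pose H a : 'Hom(B a, cofree_pmod a) :=
  if @idP (le_pt a p) is ReflectT ap then (G a ap \o F \o pm_map B ap)%VF else 0.
have HE a (ap : le_pt a p) x : pm_map cofree_pmod ap (H a x) = F (pm_map B ap x).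
  rewrite /H; case: {-}_ / idP => [ap'|] //.
  by rewrite (bool_irrelevance ap ap') !comp_lfunE KG.
have [|f fE] := @exists_pmor B cofree_pmod H.
  move=> a b h x; have [bp|bp] := boolP (le_pt b p).
    have ap := le_pt_trans h bp.
    apply: (lfun_bij_inj (bij b bp)).
    by rewrite HE (pm_mapC _ _ ap) (pm_mapC _ _ ap) HE.
  exact: cofree_pmod_eq.
exists f; apply/lfunP => x.
by rewrite fE -[LHS](pm_map1 (le_ptxx p)) HE pm_map1.
Qed.

(** The value at [p] becomes [V] only after rewriting with [le_ptxx], so the identification is given
    as a bijection. *)
Lemma exists_cofree_iso : exists g : 'Hom(V, cofree_pmod p), lfun_bij g.
Proof.
rewrite /= /cofree_space le_ptxx; exists \1%VF, \1%VF.
by split=> x; rewrite !id_lfunE.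
Qed.

End Cofree.

Section Cokernel.
Context (A B C : pmod) (f : pmor A B) (q : pmor B C) (fq : is_cokernel f q).

Lemma cokernel_eq0 a x : q a (f a x) = 0.
Proof. by have [/(_ a)/lfunP/(_ x)] := fq; rewrite comp_lfunE lfunE. Qed.

Lemma cokernel_ext D (u v : pmor C D) : pmor_comp u q = pmor_comp v q -> u = v.
Proof.
move=> uv; have [_ /(_ D (pmor_comp v q))[a|w [_ wP]]] := fq.
  by apply/lfunP => x; rewrite !comp_lfunE cokernel_eq0 raddf0 lfunE.
by rewrite -(wP _ uv) (wP v).
Qed.

Lemma cokernel_lift D (h : pmor B D) : (forall a x, h a (f a x) = 0) ->
  exists u : pmor C D, pmor_comp u q = h.
Proof.
move=> hf; have [_ /(_ D h)[a|w [wP _]]] := fq; last by exists w.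
by apply/lfunP => x; rewrite !comp_lfunE hf lfunE.
Qed.

(** [q p] is an epimorphism of vector spaces: by adjunction, [u] and [v] become morphisms into a
    cofree module, where the universal property applies. *)
Lemma cokernel_at_ext (V : vectType K) p (u v : 'Hom(C p, V)) :
  (forall x, u (q p x) = v (q p x)) -> forall y, u y = v y.
Proof.
move=> uv y; have [g gb] := exists_cofree_iso V p.
have [u' u'E] := exists_cofree_pmod_mor (g \o u)%VF.
have [v' v'E] := exists_cofree_pmod_mor (g \o v)%VF.
have e : u' = v'.
  apply: cokernel_ext; apply: cofree_pmod_ext; apply/lfunP => x.
  by rewrite !pmor_compE u'E v'E !comp_lfunE uv.
by apply: (lfun_bij_inj gb); rewrite -!comp_lfunE -u'E -v'E e.
Qed.

(** Together with [cokernel_at_ext], this makes [C p] the cokernel of [f p]. *)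
Lemma cokernel_at_lift (V : vectType K) p (h : 'Hom(B p, V)) :
  (forall x, h (f p x) = 0) -> exists u : 'Hom(C p, V), forall x, u (q p x) = h x.
Proof.
move=> hf; have [g [g' [gK g'K]]] := exists_cofree_iso V p.
have [h' h'E] := exists_cofree_pmod_mor (g \o h)%VF.
have [a x|u uE] := @cokernel_lift _ h'.
  have [z zE] := exists_zero A (cofree_pmod V p).
  rewrite -pmor_compE (_ : pmor_comp h' f = z) ?zE //.
  apply: cofree_pmod_ext; apply/lfunP => y.
  by rewrite pmor_compE h'E comp_lfunE hf raddf0 zE.
exists (g' \o u p)%VF => x.
by rewrite comp_lfunE -pmor_compE uE h'E comp_lfunE gK.
Qed.

(** The inverse on [B] descends to [C], because every relation at [b] already comes from [a]. *)
Lemma cokernel_map_bij a b (h : le_pt a b) :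
  lfun_bij (pm_map A h) -> lfun_bij (pm_map B h) -> lfun_bij (pm_map C h).
Proof.
move=> /lfun_bij_surj Asurj [g [gK Kg]].
have [x|u uE] := @cokernel_at_lift (C a) b (q a \o g)%VF.
  have [y <-] := Asurj x.
  by rewrite mor_natE comp_lfunE gK cokernel_eq0.
exists u; split=> y.
  have := @cokernel_at_ext (C a) a (u \o pm_map C h)%VF \1%VF.
  rewrite /= => /(_ _ y); rewrite comp_lfunE id_lfunE; apply=> x.
  by rewrite comp_lfunE id_lfunE -mor_natE uE comp_lfunE gK.
have := @cokernel_at_ext (C b) b (pm_map C h \o u)%VF \1%VF.
move=> /(_ _ y); rewrite comp_lfunE id_lfunE; apply=> x.
by rewrite comp_lfunE id_lfunE uE comp_lfunE -mor_natE Kg.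
Qed.

End Cokernel.

(** * Finite presentations *)

Section Presentation.
Context (J I : seq pt) (M : pmod).
Context (f : pmor (free_sum K J) (free_sum K I)) (q : pmor (free_sum K I) M).
Context (fq : is_cokernel f q).

Lemma presentation_ext D (h h' : pmor M D) :
  (forall i, i \in I -> forall x, h i x = h' i x) -> h = h'.
Proof.
move=> hh'; apply: (cokernel_ext fq); apply: free_sum_ext => i iI.
by apply/lfunP => x; rewrite !pmor_compE hh'.
Qed.

Lemma presentation_inj N N' (t : pmor N N') (h h' : pmor M N) :
  (forall i, i \in I -> injective (t i)) ->
  pmor_comp t h = pmor_comp t h' -> h = h'.
Proof.
move=> tinj thh'; apply: presentation_ext => i iI x.
by apply: (tinj _ iI); rewrite -!pmor_compE thh'.
Qed.

(** Generators lift by bijectivity of [t] at the grades in [I]. The lift kills the relations,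
    because its composite with [t] does and [t] is injective at the grades in [J]. *)
Lemma presentation_lift N N' (t : pmor N N') (h : pmor M N') :
  (forall i, i \in I -> lfun_bij (t i)) ->
  (forall j, j \in J -> injective (t j)) ->
  exists u : pmor M N, pmor_comp t u = h.
Proof.
move=> tI tJ; have [g gE] := exists_free_sum_lift (pmor_comp h q) tI.
have [z zE] := exists_zero (free_sum K J) N.
have gf : pmor_comp g f = z.
  apply: free_sum_ext => j jJ; apply/lfunP => x; apply: (tJ _ jJ).
  rewrite zE raddf0 pmor_compE -pmor_compE gE pmor_compE.
  by rewrite (cokernel_eq0 fq) raddf0.
have [a x|u uE] := @cokernel_lift _ _ _ _ _ fq N g.
  by rewrite -pmor_compE gf zE.
exists u; apply: (cokernel_ext fq).
by rewrite -pmor_compA uE.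
Qed.

Lemma presentation_map_bij a b (h : le_pt a b) :
  (forall i, i \in J ++ I -> le_pt i b -> le_pt i a) -> lfun_bij (pm_map M h).
Proof.
move=> hP; apply: (cokernel_map_bij fq); apply: free_sum_map_bij => i iP;
  by apply: hP; rewrite mem_cat iP ?orbT.
Qed.

End Presentation.

(** Being a cokernel is transported along the isomorphism, so [M] itself can serve as the
    cokernel. *)
Lemma finitely_presentableP M : finitely_presentable M ->
  exists (J I : seq pt) (f : pmor (free_sum K J) (free_sum K I))
         (q : pmor (free_sum K I) M), is_cokernel f q.
Proof.
move=> [J [I [f [C [q [fq [u [v [vu uv]]]]]]]]]; exists J, I, f, (pmor_comp v q).
split=> [a|D h hf].
  by apply/lfunP => x; rewrite !comp_lfunE (cokernel_eq0 fq) raddf0 lfunE.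
have [_ /(_ D h hf)[w [wE wP]]] := fq.
exists (pmor_comp w u); split=> [|w' w'E].
  by rewrite -pmor_compA (pmor_compA u) uv pmor_comp1l.
rewrite (wP (pmor_comp w' v)); last by rewrite -pmor_compA.
by rewrite -pmor_compA vu pmor_comp1r.
Qed.

(** * Fitting's lemma *)

Lemma piso_of_bij M N (f : pmor M N) : (forall a, lfun_bij (f a)) -> piso M N.
Proof.
move=> fb; pose g a := sval (cid (fb a)).
have fK a : cancel (f a) (g a) by have [] := svalP (cid (fb a)).
have gK a : cancel (g a) (f a) by have [] := svalP (cid (fb a)).
have [|h hE] := @exists_pmor N M g.
  by move=> a b h x; apply: (can_inj (fK b)); rewrite gK mor_natE gK.
by apply/pisoP; exists f, h; split=> a x; rewrite !hE ?fK ?gK.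
Qed.

Section Submodule.
Context (A : pmod) (U : forall a, {vspace A a}).
Context (stableU : forall a b (h : le_pt a b) x,
  x \in U a -> pm_map A h x \in U b).

(** By [stableU] the image already lies in [U b], so [vsproj] only changes the type. *)
Definition sub_map a b (h : le_pt a b) : 'Hom(subvs_of (U a), subvs_of (U b)) :=
  linfun (vsproj (U b) \o pm_map A h \o vsval).

Lemma vsval_sub_map a b (h : le_pt a b) x :
  vsval (sub_map h x) = pm_map A h (vsval x).
Proof. by rewrite lfunE /= vsprojK // stableU // subvsP. Qed.

Fact sub_id a (h : le_pt a a) : sub_map h = \1%VF.
Proof.
by apply/lfunP => x; apply: val_inj; rewrite /= vsval_sub_map pm_map1 id_lfunE.
Qed.

Fact sub_comp a b c (h : le_pt a b) (k : le_pt b c) (l : le_pt a c) :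
  (sub_map k \o sub_map h)%VF = sub_map l.
Proof.
apply/lfunP => x; apply: val_inj.
by rewrite /= comp_lfunE !vsval_sub_map (pm_mapC _ _ l).
Qed.

Definition sub_pmod : pmod := PMod sub_id sub_comp.

Lemma sub_pmod_eq0 : is_zero sub_pmod -> forall a x, x \in U a -> x = 0.
Proof.
move=> z a x xU; have /(congr1 vsval) := z a (vsproj _ x).
by rewrite vsprojK.
Qed.

End Submodule.

(** Internal direct sum: adding the two inclusions gives a morphism that is bijective at each
    grade. *)
Lemma piso_dsum_sub A (U W : forall a, {vspace A a})
    (sU : forall a b (h : le_pt a b) x, x \in U a -> pm_map A h x \in U b)
    (sW : forall a b (h : le_pt a b) x, x \in W a -> pm_map A h x \in W b) :
  (forall a x, x \in U a -> x \in W a -> x = 0) ->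
  (forall a x, exists2 u, u \in U a & x - u \in W a) ->
  piso A (dsum (sub_pmod sU) (sub_pmod sW)).
Proof.
move=> UW0 UWT; apply: piso_sym.
have [|f fE] := @exists_pmor (dsum (sub_pmod sU) (sub_pmod sW)) A
    (fun a => linfun (vsval \o fst) + linfun (vsval \o snd)).
  move=> a b h x; rewrite dsum_mapE !lfunE /= !lfunE /= raddfD.
  by congr (_ + _); rewrite vsprojK ?sU ?sW ?subvsP.
have {}fE a x : f a x = vsval x.1 + vsval x.2 by rewrite fE !lfunE /= !lfunE.
apply: (@piso_of_bij _ _ f) => a; apply: lfun_bijI.
  move=> [u w] [u' w']; rewrite !fE /= => e.
  have d : vsval u - vsval u' = vsval w' - vsval w.
    by apply/eqP; rewrite subr_eq addrAC eq_sym subr_eq addrC e addrC.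
  have d0 : vsval u - vsval u' = 0.
    by apply: (UW0 a); last rewrite d; apply: rpredB; apply: subvsP.
  congr pair; apply: val_inj; first by apply/eqP; rewrite -subr_eq0 d0.
  by apply/esym/eqP; rewrite -subr_eq0 -d d0.
move=> x; have [u uU xuW] := UWT a x.
by exists (vsproj _ u, vsproj _ (x - u)); rewrite fE /= !vsprojK // addrC subrK.
Qed.

Lemma mor_iterE A (f : pmor A A) a b (h : le_pt a b) k x :
  iter k (f b) (pm_map A h x) = pm_map A h (iter k (f a) x).
Proof. by elim: k => //= k ->; rewrite mor_natE. Qed.

(* Fitting's lemma, applied pointwise: the splittings of the [A a] into the
   nilpotent and the bijective part of [f a] are natural in [a], although the
   nilpotency index may depend on [a]. *)
Lemma indecomposable_endo A (f : pmor A A) : indecomposable A ->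
  (forall a y, exists x, f a x = y) \/ (forall a y, exists x, x - f a x = y).
Proof.
move=> [_ Adec].
pose k a := sval (cid (fitting_index (f a))).
have kP a := svalP (cid (fitting_index (f a))).
pose U a := lker (lfun_iter (k a) (f a)).
pose W a := limg (lfun_iter (k a) (f a)).
have UP a x : reflect (iter (k a) (f a) x = 0) (x \in U a).
  by rewrite memv_ker lfun_iterE; exact: eqP.
have WP a x : x \in W a -> exists y, x = iter (k a) (f a) y.
  by move=> /memv_imgP[y _]; rewrite lfun_iterE; exists y.
have WI a y : iter (k a) (f a) y \in W a.
  by rewrite -lfun_iterE memv_img ?memvf.
have sU a b (h : le_pt a b) x : x \in U a -> pm_map A h x \in U b.
  move=> /UP xU; apply/UP; have [_] := kP b (k a) (pm_map A h x); apply.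
  by rewrite mor_iterE xU raddf0.
have sW a b (h : le_pt a b) x : x \in W a -> pm_map A h x \in W b.
  (* Writing the element with [k b] extra iterations makes its image a value of the [k b]-th iterate
     at [b]. *)
  move=> /WP[y ->]; have [[z ->] _] := kP a (k b + k a)%N y.
  by rewrite -mor_iterE iterD WI.
have UW0 a x : x \in U a -> x \in W a -> x = 0.
  move=> /UP xU /WP[y xE]; rewrite xE; have [_] := kP a (k a + k a)%N y; apply.
  by rewrite iterD -xE.
have iterB a m x y : iter m (f a) (x - y) = iter m (f a) x - iter m (f a) y.
  by rewrite -!lfun_iterE raddfB.
have UWT a x : exists2 u, u \in U a & x - u \in W a.
  (* The [k a]-th iterate of [x] is the (2 [k a])-th iterate of some [y]; subtracting the [k a]-th
     iterate of [y] from [x] leaves an element of the kernel. *)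
  have [[y yE] _] := kP a (k a + k a)%N x.
  exists (x - iter (k a) (f a) y); last by rewrite subKr WI.
  by apply/UP; rewrite iterB yE iterD subrr.
have [U0|U0] := EM (is_zero (sub_pmod sU)).
  left=> a y; have [[z zE] _] := kP a (k a).+1 y; exists z.
  apply/esym/eqP; rewrite -subr_eq0; apply/eqP; apply: (sub_pmod_eq0 U0).
  by apply/UP; rewrite iterB zE iterSr subrr.
have [W0|W0] := EM (is_zero (sub_pmod sW)).
  (* Here [f] is nilpotent at each grade. *)
  right=> a; apply: (@lfun_sub_nilp_surj _ _ (k a)) => x.
  exact: (sub_pmod_eq0 W0 (WI a x)).
by case: Adec; exists (sub_pmod sU), (sub_pmod sW); split=> //; exact: piso_dsum_sub.
Qed.

Definition eta_trivial (r : R) (r0 : 0 <= r) M : Prop :=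
  forall a, pm_map M (le_shift_pt a r0) = 0.

Lemma eta_trivial_dsum (r : R) (r0 : 0 <= r) X Y :
  eta_trivial r0 X -> eta_trivial r0 Y -> eta_trivial r0 (dsum X Y).
Proof.
move=> X0 Y0 a; apply/lfunP => x.
by rewrite dsum_mapE X0 Y0 !lfunE.
Qed.

Section IdempotentTrivial.
Context (M A B : pmod) (r : R) (r0 : 0 <= r).
Context (MAB : piso M (dsum A B)).
Context (B0 : eta_trivial r0 B) (Aind : indecomposable A).
Local Notation eta := (pm_map M (le_shift_pt _ r0)).

(* If [A -> M -> A] is onto through [e], then [M] is generated by the image of
   [e] and by [B], so that the image of [e'] is a quotient of [B]. *)
Lemma eta_idempotent_surj (u : pmor M (dsum A B)) (v : pmor (dsum A B) M)
    (e e' : pmor M M) :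
  (forall a, cancel (u a) (v a)) ->
  (forall a x, e' a (e a x) = 0) -> (forall a x, e' a (e' a x) = e' a x) ->
  (forall a (y : A a), exists x : A a, (u a (e a (v a (x, 0)))).1 = y) ->
  forall a x, eta (e' a x) = 0.
Proof.
move=> uK e'e e'e' esurj a x.
have [y yE] := esurj a (u a (e' a x)).1.
(* The choice of [y] cancels the component of [b] in [A], so [b] lies in the copy of [B]; and [e']
   maps [b] to [e' a x]. *)
pose b := e' a x - e a (v a (y, 0)).
have b0 : eta b = 0.
  apply: (can_inj (uK _)); rewrite mor_natE raddf0 dsum_mapE B0 lfunE /=.
  by rewrite /b raddfB /= yE subrr raddf0.
have -> : e' a x = e' a b by rewrite /b raddfB /= e'e' e'e subr0.
by rewrite -mor_natE b0 raddf0.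
Qed.

(** Let [f] be the compression of [e] to [A]. Then 1 - f is the compression of 1 - e, and one of the
    two is onto by [indecomposable_endo]. *)
Lemma eta_idempotent (e : pmor M M) : (forall a x, e a (e a x) = e a x) ->
  (forall a x, eta (e a x) = 0) \/ (forall a x, eta (x - e a x) = 0).
Proof.
move=> ee; have /pisoP[u [v [uK vK]]] := MAB.
have [e' e'E] := exists_sub (pmor_id M) e.
have {}e'E a x : e' a x = x - e a x by rewrite e'E pmor_idE.
have [i iE] := exists_dsum_inl A B.
have [p pE] := exists_dsum_fst A B.
pose f := pmor_comp p (pmor_comp u (pmor_comp e (pmor_comp v i))).
have fE a x : f a x = (u a (e a (v a (x, 0)))).1.
  by rewrite !pmor_compE pE iE.
have [fs|fs] := indecomposable_endo f Aind; [right|left] => a x.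
  rewrite -e'E; apply: (eta_idempotent_surj (u := u) (v := v) (e := e)) => //.
  - by move=> b y; rewrite e'E ee subrr.
  - by move=> b y; rewrite !e'E raddfB /= ee subrr subr0.
  - by move=> b y; have [z <-] := fs b y; exists z; rewrite fE.
apply: (eta_idempotent_surj (u := u) (v := v) (e := e')) => //.
- by move=> b y; rewrite e'E raddfB /= ee subrr.
- move=> b y; have [z <-] := fs b y; exists z.
  by rewrite fE e'E raddfB /= vK.
Qed.

End IdempotentTrivial.

(** * Interleavings *)

(** Take for [r0] a lower bound of the finitely many positive differences between coordinates of
    points of [s]: a smaller shift cannot make up for any of them. *)
Lemma exists_gap (s : seq pt) : exists2 r0 : R, 0 < r0 &
  forall r i p, r < r0 -> i \in s -> p \in s ->
    le_pt i (shift_pt p r) -> le_pt i p.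
Proof.
have pos (t : seq R) :
    exists2 r0 : R, 0 < r0 & forall x, x \in t -> 0 < x -> r0 <= x.
  elim: t => [|y t [r0 r00 IH]]; first by exists 1.
  exists (if 0 < y then Num.min y r0 else r0).
    by case: ifP => // y0; rewrite lt_min y0.
  move=> x; rewrite inE => /orP[/eqP -> y0|xt x0].
    by rewrite y0 ge_min lexx.
  by case: ifP => _; rewrite ?ge_min IH // orbT.
have [r0 r00 r0P] := pos [seq (x : pt * pt).1 ord0 k - x.2 ord0 k |
  x <- [seq (i, p) | i <- s, p <- s], k <- enum 'I_n].
exists r0 => // r i p rr0 iS pS /forallP ipr; apply/forallP => k.
rewrite leNgt; apply/negP => pik.
have := ipr k; rewrite !mxE => ik.
have : r0 <= i ord0 k - p ord0 k.
  apply: r0P; last by rewrite subr_gt0.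
  apply/allpairsP; exists ((i, p), k); split=> //=; last by rewrite mem_enum.
  by apply/allpairsP; exists (i, p).
by lra.
Qed.

(** The structure morphism from [M] to M[4d]. *)
Definition eta4 (d : R) (d0 : 0 <= d) M :=
  pmor_comp (eta2 d0 (shift_pmod d (shift_pmod d M))) (eta2 d0 M).

Definition eta2_lifting (d : R) (d0 : 0 <= d) M : Prop :=
  forall h : pmor M (shift_pmod d (shift_pmod d M)),
    exists u, pmor_comp (eta2 d0 M) u = h.

Definition eta4_mono (d : R) (d0 : 0 <= d) M : Prop :=
  forall h h' : pmor M M,
    pmor_comp (eta4 d0 M) h = pmor_comp (eta4 d0 M) h' -> h = h'.

(** With [r] the gap of the grades of generators and relations, none of these grades is newly passed
    between such a grade and its shift by 4d, so [M] is constant there. *)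
Lemma finitely_presentable_gap M : finitely_presentable M ->
  exists2 r : R, 0 < r & forall d (d0 : 0 <= d), d *+ 4 < r ->
    eta2_lifting d0 M /\ eta4_mono d0 M.
Proof.
move=> /finitely_presentableP[J [I [f [q fq]]]].
have [r r0 rP] := exists_gap (J ++ I).
have bij p b (h : le_pt p b) t :
    p \in J ++ I -> t < r -> le_pt b (shift_pt p t) -> lfun_bij (pm_map M h).
  move=> pJI tr bt; apply: (presentation_map_bij fq) => i iJI ib.
  by apply: (rP t) => //; exact: le_pt_trans ib bt.
exists r => // d d0 dr.
have bij2 p : p \in J ++ I -> lfun_bij (eta2 d0 M p).
  move=> pJI; apply: (bij _ _ _ (d *+ 4) pJI dr).
  by apply/forallP => k; rewrite !mxE; lra.
split=> [h|h h'].
  apply: (presentation_lift fq) => p pP.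
    by apply: bij2; rewrite mem_cat pP orbT.
  by apply: lfun_bij_inj; apply: bij2; rewrite mem_cat pP.
apply: (presentation_inj fq) => p pI x y.
have h4 : le_pt p (shift_pt (shift_pt (shift_pt (shift_pt p d) d) d) d).
  exact: le_pt_trans (le_shift_pt2 _ d0) (le_shift_pt2 _ d0).
rewrite !pmor_compE /= !(pm_mapC _ _ h4); apply: lfun_bij_inj.
apply: (bij _ _ _ (d *+ 4)) => //; first by rewrite mem_cat pI orbT.
by apply/forallP => k; rewrite !mxE; lra.
Qed.

Section Interleaving.
Context (M N : pmod) (d : R) (d0 : 0 <= d).
Context (f : pmor M (shift_pmod d N)) (g : pmor N (shift_pmod d M)).
Context (fg : forall a x,
  f (shift_pt a d) (g a x) = pm_map N (le_shift_pt2 a d0) x).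

(** [E] is [e] carried through the interleaving, up to the shift by 2d. *)
Definition transfers (E : pmor M M) (e : pmor N N) : Prop :=
  forall a x, pm_map M (le_shift_pt2 a d0) (E a x) =
              g (shift_pt a d) (e (shift_pt a d) (f a x)).

(** Followed by [eta4], the square of [E] becomes g e f g e f. As f g is a structure map, naturality
    and e e = e turn this into [eta4] after [E], and [eta4] cancels. *)
Lemma transfers_idempotent (E : pmor M M) (e : pmor N N) :
  eta4_mono d0 M -> transfers E e -> (forall a x, e a (e a x) = e a x) ->
  forall a x, E a (E a x) = E a x.
Proof.
move=> inj Ee ee a x; rewrite -pmor_compE; congr (mor_at _ _ x).
congr mor_at; apply: inj; apply: pmorP => {}a {}x.
rewrite !pmor_compE /=.
pose h4 := le_shift_pt2 (shift_pt (shift_pt a d) d) d0.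
rewrite (bool_irrelevance (le_pt_shift _ _) h4).
rewrite -mor_natE (Ee a) (Ee (shift_pt (shift_pt a d) d)) fg.
by rewrite mor_natE ee mor_natE /= (bool_irrelevance (le_pt_shift _ _) h4).
Qed.

(** The composite f g e f g is [e] followed by the shift by 4d, and it factors through [E]. By
    naturality a further shift by [r] can be applied directly after [E], where it gives zero. *)
Lemma transfers_trivial (E : pmor M M) (e : pmor N N) (r : R) (r0 : 0 <= r)
    (s0 : 0 <= d *+ 4 + r) :
  transfers E e -> (forall a x, pm_map M (le_shift_pt a r0) (E a x) = 0) ->
  forall a x, pm_map N (le_shift_pt a s0) (e a x) = 0.
Proof.
move=> Ee E0 a y; have d_ge0 := d0.
pose z := E _ (g a y); pose a1 := shift_pt a d.
pose a3 := shift_pt (shift_pt a1 d) d.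
(* [c] is [a3] shifted by [r]. The points [shift_pt c d] and a + 4d + r are equal but not
   convertible, so [le_cs] links them. *)
pose c := shift_pt a (d *+ 3 + r).
have le_a4 : le_pt a (shift_pt a3 d).
  by apply/forallP => k; rewrite /c /a3 /a1 !mxE; lra.
have le_a4s : le_pt (shift_pt a3 d) (shift_pt a (d *+ 4 + r)).
  by apply/forallP => k; rewrite /c /a3 /a1 !mxE; lra.
have le_cs : le_pt (shift_pt c d) (shift_pt a (d *+ 4 + r)).
  by apply/forallP => k; rewrite /c /a3 /a1 !mxE; lra.
have le_a3c : le_pt a3 c by apply/forallP => k; rewrite /c /a3 /a1 !mxE; lra.
have le_1rc : le_pt (shift_pt a1 r) c.
  by apply/forallP => k; rewrite /c /a3 /a1 !mxE; lra.
have le_1c : le_pt a1 c by exact: le_pt_trans (le_shift_pt a1 r0) le_1rc.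
have fz : f a3 (pm_map M (le_shift_pt2 a1 d0) z) = pm_map N le_a4 (e a y).
  by rewrite /z Ee !fg mor_natE (pm_mapC _ _ le_a4).
rewrite -(pm_mapC le_a4 le_a4s) -fz.
have -> : pm_map N le_a4s (f a3 (pm_map M (le_shift_pt2 a1 d0) z)) =
    pm_map N le_cs (f c (pm_map M le_a3c (pm_map M (le_shift_pt2 a1 d0) z))).
  by rewrite mor_natE (pm_mapC _ _ le_a4s).
by rewrite (pm_mapC _ _ le_1c) -(pm_mapC (le_shift_pt a1 r0) le_1rc) E0 !raddf0.
Qed.

End Interleaving.

Lemma interleaved_summand M N A B X Y (d r : R) (d0 : 0 <= d) (r0 : 0 <= r)
    (s0 : 0 <= d *+ 4 + r)
    (f : pmor M (shift_pmod d N)) (g : pmor N (shift_pmod d M)) :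
  eta2_lifting d0 M -> eta4_mono d0 M ->
  pmor_comp (shift_pmor d g) f = eta2 d0 M ->
  pmor_comp (shift_pmor d f) g = eta2 d0 N ->
  piso M (dsum A B) -> indecomposable A -> eta_trivial r0 B ->
  piso N (dsum X Y) -> eta_trivial s0 X \/ eta_trivial s0 Y.
Proof.
move=> lift inj gf' fg' MAB Aind B0 /pisoP[u [v [uK vK]]].
have gf a x : g (shift_pt a d) (f a x) = pm_map M (le_shift_pt2 a d0) x.
  by have /(congr1 (fun h : pmor _ _ => h a x)) := gf'; rewrite pmor_compE.
have fg a x : f (shift_pt a d) (g a x) = pm_map N (le_shift_pt2 a d0) x.
  by have /(congr1 (fun h : pmor _ _ => h a x)) := fg'; rewrite pmor_compE.
have [i iE] := exists_dsum_inl X Y.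
have [p pE] := exists_dsum_fst X Y.
(* The projection of [N] onto [X]. *)
pose e := pmor_comp v (pmor_comp i (pmor_comp p u)).
have eE a x : e a x = v a ((u a x).1, 0) by rewrite !pmor_compE iE pE.
have ee a x : e a (e a x) = e a x by rewrite !eE vK.
have [e' e'E] := exists_sub (pmor_id N) e.
have [E EE] := lift (pmor_comp (shift_pmor d g) (pmor_comp (shift_pmor d e) f)).
have Ee : transfers d0 f g E e.
  move=> a x; have /(congr1 (fun h : pmor _ _ => h a x)) := EE.
  by rewrite !pmor_compE.
have [E' E'E] := exists_sub (pmor_id M) E.
(* The identities correspond because g f is the structure map, and the relation is additive. *)
have E'e' : transfers d0 f g E' e'.
  by move=> a x; rewrite E'E e'E !pmor_idE !raddfB /= Ee gf.
have EE1 := transfers_idempotent fg inj Ee ee.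
have [E0|E0] := eta_idempotent MAB B0 Aind EE1; [left|right] => a.
  apply/lfunP => x; rewrite lfunE /=.
  have := transfers_trivial fg s0 Ee E0 (v a (x, 0)).
  rewrite eE vK -mor_natE => /(congr1 (u _)).
  by rewrite vK raddf0 dsum_mapE => -[].
have {}E0 b x : pm_map M (le_shift_pt b r0) (E' b x) = 0 by rewrite E'E pmor_idE.
apply/lfunP => y; rewrite lfunE /=.
have := transfers_trivial fg s0 E'e' E0 (v a (0, y)).
rewrite e'E pmor_idE eE vK (_ : (0, 0) = 0) // raddf0 subr0 -mor_natE.
by move=> /(congr1 (u _)); rewrite vK raddf0 dsum_mapE => -[].
Qed.

(** * Splitting off an indecomposable summand *)

Lemma exists_dsum_pair L A B (f : pmor L A) (g : pmor L B) :
  exists h : pmor L (dsum A B), forall a x, h a x = (f a x, g a x).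
Proof.
have [u uE] := exists_dsum_inl A B; have [v vE] := exists_dsum_inr A B.
have [h hE] := exists_add (pmor_comp u f) (pmor_comp v g).
exists h => a x; rewrite hE !pmor_compE uE vE.
by congr pair; rewrite ?addr0 ?add0r.
Qed.

Lemma piso_dsum A B A' B' : piso A A' -> piso B B' -> piso (dsum A B) (dsum A' B').
Proof.
move=> /pisoP[f [f' [fK f'K]]] /pisoP[g [g' [gK g'K]]]; apply/pisoP.
have [p pE] := exists_dsum_fst A B; have [q qE] := exists_dsum_snd A B.
have [p' p'E] := exists_dsum_fst A' B'; have [q' q'E] := exists_dsum_snd A' B'.
have [h hE] := exists_dsum_pair (pmor_comp f p) (pmor_comp g q).
have [h' h'E] := exists_dsum_pair (pmor_comp f' p') (pmor_comp g' q').
by exists h, h'; split=> a [x y];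
  rewrite hE h'E !pmor_compE ?pE ?qE ?p'E ?q'E /= ?fK ?gK ?f'K ?g'K.
Qed.

Lemma piso_dsumC A B : piso (dsum A B) (dsum B A).
Proof.
apply/pisoP.
have [p pE] := exists_dsum_fst A B; have [q qE] := exists_dsum_snd A B.
have [p' p'E] := exists_dsum_fst B A; have [q' q'E] := exists_dsum_snd B A.
have [h hE] := exists_dsum_pair q p; have [h' h'E] := exists_dsum_pair q' p'.
by exists h, h'; split=> a [x y]; rewrite hE h'E pE qE p'E q'E.
Qed.

Lemma piso_dsumA A B C : piso (dsum (dsum A B) C) (dsum A (dsum B C)).
Proof.
apply/pisoP.
have [p pE] := exists_dsum_fst (dsum A B) C.
have [q qE] := exists_dsum_snd (dsum A B) C.
have [pp ppE] := exists_dsum_fst A B; have [pq pqE] := exists_dsum_snd A B.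
have [p' p'E] := exists_dsum_fst A (dsum B C).
have [q' q'E] := exists_dsum_snd A (dsum B C).
have [qp qpE] := exists_dsum_fst B C; have [qq qqE] := exists_dsum_snd B C.
have [k kE] := exists_dsum_pair (pmor_comp pq p) q.
have [h hE] := exists_dsum_pair (pmor_comp pp p) k.
have [k' k'E] := exists_dsum_pair p' (pmor_comp qp q').
have [h' h'E] := exists_dsum_pair k' (pmor_comp qq q').
exists h, h'; split=> a.
  by move=> [[x y] z]; rewrite h'E hE k'E kE !pmor_compE p'E q'E qpE qqE
    pE qE ppE pqE.
by move=> [x [y z]]; rewrite h'E hE k'E kE !pmor_compE p'E q'E qpE qqE
    pE qE ppE pqE.
Qed.

Lemma piso_dsum0 A : piso A (dsum A (zero_pmod K R n)).
Proof.
apply: piso_sym; apply/pisoP.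
have [p pE] := exists_dsum_fst A (zero_pmod K R n).
have [i iE] := exists_dsum_inl A (zero_pmod K R n).
exists p, i; split=> a; last by move=> x; rewrite iE pE.
by move=> [x y]; rewrite pE iE; congr pair; rewrite [RHS]thinmx0.
Qed.

(** Generation is stated through maps out of [M], a form that passes to summands by composing with
    the projection. *)
Definition generated_at (I : seq pt) M : Prop :=
  forall D (h h' : pmor M D),
    (forall i, i \in I -> forall x, h i x = h' i x) -> h = h'.

Lemma generated_at_summand I M X Y :
  piso M (dsum X Y) -> generated_at I M -> generated_at I X.
Proof.
move=> /pisoP[u [v [uK vK]]] gen D h h' hh'.
have [p pE] := exists_dsum_fst X Y; have [i iE] := exists_dsum_inl X Y.
have e : pmor_comp h (pmor_comp p u) = pmor_comp h' (pmor_comp p u).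
  by apply: gen => j jI x; rewrite !pmor_compE hh'.
apply: pmorP => a x; have := congr1 (fun k : pmor _ _ => k a (v a (x, 0))) e.
by rewrite !pmor_compE vK pE.
Qed.

(** The induction measure for splitting off summands. *)
Definition total_dim (I : seq pt) M : nat := (\sum_(i <- I) dim (M i))%N.

Lemma total_dim_piso I M N : piso M N -> total_dim I M = total_dim I N.
Proof.
move=> /pisoP[u [v [uK vK]]]; apply: eq_bigr => i _; apply: (@lfun_bij_dim _ _ _ (u i)).
by exists (v i).
Qed.

Lemma total_dim_dsum I X Y :
  total_dim I (dsum X Y) = (total_dim I X + total_dim I Y)%N.
Proof. exact: big_split. Qed.

(** If [X] vanished at all grades in [I], its identity and zero endomorphisms would agree there,
    hence everywhere. *)
Lemma total_dim_gt0 I X : generated_at I X -> ~ is_zero X -> (0 < total_dim I X)%N.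
Proof.
move=> gen X0; rewrite lt0n; apply/negP => /eqP d0; apply: X0 => a x.
have [z zE] := exists_zero X X.
rewrite -(zE a x) -[LHS](pmor_idE x); congr (mor_at _ _ x); congr mor_at.
apply: gen => i iI y; rewrite zE pmor_idE.
have di : dim (X i) = 0%N.
  apply/eqP; move/eqP: d0; rewrite /total_dim sum_nat_seq_eq0 => /allP/(_ i iI).
  by [].
have : y \in (fullv : {vspace X i}) by exact: memvf.
have /eqP -> : (fullv : {vspace X i}) == 0%VS by rewrite -dimv_eq0 dimvf di.
by rewrite memv0 => /eqP.
Qed.

Lemma exists_indecomposable_summand I N (s : R) (s0 : 0 <= s) :
  generated_at I N -> ~ is_zero N ->
  (forall X Y, piso N (dsum X Y) -> eta_trivial s0 X \/ eta_trivial s0 Y) ->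
  exists A B, [/\ indecomposable A, eta_trivial s0 B & piso N (dsum A B)].
Proof.
move=> genN N0 Ntriv.
suff H m X Y : (total_dim I X < m)%N -> piso N (dsum X Y) -> ~ is_zero X ->
    eta_trivial s0 Y ->
    exists A B, [/\ indecomposable A, eta_trivial s0 B & piso N (dsum A B)].
  (* Start from the splitting of [N] as itself plus zero. *)
  apply: (H (total_dim I N).+1 N (zero_pmod K R n)) => //; first exact: piso_dsum0.
  by move=> a; apply/lfunP => x; rewrite thinmx0 [RHS]thinmx0.
elim: m X Y => // m IHm X Y Xm NXY X0 Y0.
have [Xdec|Xdec] := EM (decomposable X); last by exists X, Y; split.
have {Xdec}[X1 [X2 [X10 X20 XX12]]] := Xdec.
have N1 : piso N (dsum X1 (dsum X2 Y)).
  apply: piso_trans NXY _; apply: piso_trans (piso_dsumA _ _ _).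
  exact: piso_dsum (piso_refl _).
have N2 : piso N (dsum X2 (dsum X1 Y)).
  apply: piso_trans NXY _; apply: piso_trans (piso_dsumA _ _ _).
  by apply: piso_dsum (piso_refl _); exact: piso_trans (piso_dsumC _ _).
have d1 := total_dim_gt0 (generated_at_summand N1 genN) X10.
have d2 := total_dim_gt0 (generated_at_summand N2 genN) X20.
have dX : total_dim I X = (total_dim I X1 + total_dim I X2)%N.
  by rewrite (total_dim_piso I XX12) total_dim_dsum.
(* Either [X1] is killed and joins [Y], or [X2] and [Y] are killed together. What remains of [X] has
   lost a summand of positive total dimension. *)
have [X1t|X2t] := Ntriv _ _ N1.
  apply: (IHm _ _ _ N2) => //; last exact: eta_trivial_dsum.
  by rewrite -ltnS; apply: leq_trans Xm; rewrite ltnS dX -add1n leq_add2r.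
apply: (IHm _ _ _ N1) => //.
by rewrite -ltnS; apply: leq_trans Xm; rewrite ltnS dX -addn1 leq_add2l.
Qed.

(** * Openness *)

Lemma interleaved_eps_indecomposable e M :
  finitely_presentable M -> eps_indecomposable e M ->
  exists2 delta : R, 0 < delta & forall N d, finitely_presentable N ->
    d < delta -> interleaved d M N -> eps_indecomposable e N.
Proof.
move=> Mfp [A [B [Aind [r [r0 [re B0]]] MAB]]].
have [t t0 tP] := finitely_presentable_gap Mfp.
(* 4d < t gives lifting and cancellation for [M]; 4d < e - r gives 4d + r < e. *)
exists (Num.min t (e - r) / 4).
  by rewrite divr_gt0 // lt_min t0 subr_gt0.
move=> N d Nfp dd [d0 [f [g [gf fg]]]].
have dt : d *+ 4 < Num.min t (e - r).
  by move: dd; rewrite ltr_pdivlMr // mulr_natr.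
move: dt; rewrite lt_min => /andP[dt der].
have [lift inj] := tP d d0 dt.
have s0 : 0 <= d *+ 4 + r by rewrite addr_ge0 // mulrn_wge0.
have [J [I [fN [qN fqN]]]] := finitely_presentableP Nfp.
have genN : generated_at I N by move=> D h h'; exact: (presentation_ext fqN).
(* If [N] were zero, [eta2] of [M] would factor through zero; cancelling [eta4] would make the
   identity of [M] zero, and so [A] zero. *)
have N0 : ~ is_zero N.
  move=> N0; have [A0 _] := Aind; apply: A0 => a x.
  have [z zE] := exists_zero M M.
  have idz : pmor_id M = z.
    apply: inj; rewrite /eta4 -!pmor_compA; congr pmor_comp.
    apply: pmorP => b y.
    rewrite !pmor_compE zE raddf0 pmor_idE -gf pmor_compE.
    by rewrite (N0 _ (f b y)) raddf0.
  have /pisoP[u [v [uK vK]]] := MAB.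
  have : v a (x, 0) = 0 by rewrite -[LHS]pmor_idE idz zE.
  by move=> /(congr1 (u a)); rewrite vK raddf0 => -[].
have [||X Y|A' [B' [A'ind B'0 NAB']]] :=
  @exists_indecomposable_summand I N _ s0 => //.
  exact: (interleaved_summand s0 lift inj gf fg MAB Aind B0).
exists A', B'; split=> //; exists (d *+ 4 + r), s0; split=> //.
by lra.
Qed.

(** [shift_pmod 0 M] is not convertible to [M], so the structure maps from a to a + 0 replace
    identities. *)
Lemma interleaved0 M : interleaved 0 M M.
Proof.
pose i a := pm_map M (le_shift_pt a (lexx 0)).
have [|f fE] := @exists_pmor M (shift_pmod 0 M) i.
  move=> a b h x; rewrite /i /=.
  by rewrite !(pm_mapC _ _ (le_pt_trans h (le_shift_pt b (lexx 0)))).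
exists (lexx 0), f, f; split; apply: pmorP => a x; rewrite pmor_compE /= !fE /i;
  by rewrite (pm_mapC _ _ (le_shift_pt2 a (lexx 0))).
Qed.

Lemma fpclass_ballP (c d : fpclass K R n) (M N : fpmod K R n) (r : R) :
  c M -> d N ->
  fpclass_ball c r d <-> exists2 s, s < r & interleaved s M N.
Proof.
move=> cM dN; rewrite /fpclass_ball (fpclass_distE cM dN); split.
  by move=> /ereal_inf_lt[_ [s sMN <-]]; rewrite lte_fin; exists s.
move=> [s sr sMN]; apply: le_lt_trans (_ : s%:E < _)%E; last by rewrite lte_fin.
by apply: ereal_inf_lbound; exists s.
Qed.

End Modules.

Theorem theoremB (K : fieldType) (R : realType) (n : nat) (n1 : (1 <= n)%N)
    (e : R) (e0 : 0 < e) :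
  fpclass_open (fun c : fpclass K R n => eps_indecomposable_class e c).
Proof.
move=> T [_ _ Tunion] Tball.
pose S := fun c : fpclass K R n => eps_indecomposable_class e c.
pose F := fun U : fpclass K R n -> Prop => is_fpclass_ball U /\ forall c, U c -> S c.
(* The set is the union of the balls it contains. *)
have -> : (fun c => eps_indecomposable_class e c) = fun c => exists U, F U /\ U c.
  apply: funext => c; apply: propext; split=> [[M [cM Mind]]|[U [[_ US] Uc]]];
    last exact: US.
  have [delta delta0 deltaP] := interleaved_eps_indecomposable (fp_modP M) Mind.
  exists (fpclass_ball c delta); split.
    split; first by exists c, delta.
    move=> d; have [N NP] := fpclassP d; have dN : d N by apply/NP; exact: piso_refl.
    move=> /(fpclass_ballP _ cM dN)[s sdelta MN]; exists N; split=> //.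
    exact: deltaP (fp_modP N) sdelta MN.
  by apply/(fpclass_ballP _ cM cM); exists 0 => //; exact: interleaved0.
by apply: Tunion => U [Uball _]; exact: Tball.
Qed.
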